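(* Let $p$ be a prime. The map $K^{\infty}$ (defined in the context) is a positive characteristic $p$-functor; that is, $K^{\infty}$ sends each finite $p$-group $S$ to a subgroup $K^{\infty}(S)$ of $S$ such that $K^{\infty}(S\theta) = K^{\infty}(S)\theta$ for every isomorphism $\theta$ with domain $S$, and $K^{\infty}(S) \neq 1$ whenever $S \neq 1$. Moreover the following hold for every finite $p$-group $S$: (a) If $T$ is a subgroup with $K^{\infty}(S) \leq T \leq S$, then $K^{\infty}(S) = K^{\infty}(T)$. (b) $K^{\infty}(S)$ contains every abelian normal subgroup of $S$. (c) $C_S(K^{\infty}(S)) \leq K^{\infty}(S)$. In particular $Z(S) \leq K^{\infty}(S)$.
   Context: All groups are finite. Fix a prime $p$. For a group $S$, let $\mathrm{sgp}(S)$ denote the set of all subgroups of $S$. For $\Sigma \subseteq \mathrm{sgp}(S)$, write $B \leq\in \Sigma$ to mean that $B$ is a subgroup of some member of $\Sigma$. Commutators are left-normed: $[A,B,B] = [[A,B],B]$. Definition of $\mathcal{K}(-,-)$: for a $p$-group $S$ and $\Sigma \subseteq \mathrm{sgp}(S)$, $\mathcal{K}(S,\Sigma)$ is the set of all $A \in \mathrm{sgp}(S)$ such that (i) $A$ has nilpotency class at most two (i.e. $[A,A] \leq Z(A)$); (ii) $A$ is normalized by each member of $\Sigma$; (iii) whenever $B \leq\in \Sigma$ satisfies $[A,B,B] \leq Z(A)$, then $[A,B] \leq Z(A)$. Define $\mathcal{K}_0(S) = \mathrm{sgp}(S)$ and $\mathcal{K}_{i+1}(S) = \mathcal{K}(S,\mathcal{K}_i(S))$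 for all $i \geq 0$; $\mathcal{K}^{\infty}(S) = \bigcap_{i \text{ even}} \mathcal{K}_i(S)$; and $K^{\infty}(S) = \langle\, \mathcal{K}^{\infty}(S)\,\rangle$, the subgroup of $S$ generated by all members of $\mathcal{K}^{\infty}(S)$. *)

(* Defs.v *)
From mathcomp Require Import all_boot all_fingroup all_solvable.
From mathcomp Require Import boolp.

Set Implicit Arguments.
Unset Strict Implicit.
Unset Printing Implicit Defensive.

Local Open Scope group_scope.

Section Kinfty.

Variable gT : finGroupType.
Implicit Types (S A B Q : {group gT}) (Sigma : {set {group gT}}).

Definition sub_mem B Sigma : bool := [exists Q in Sigma, B \subset Q].

Definition calK S Sigma : {set {group gT}} :=
  [set A in subgroups S |
    [&& [~: A, A] \subset 'Z(A),
        [forall Q in Sigma, Q \subset 'N(A)]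
      & [forall B : {group gT},
          sub_mem B Sigma ==> ([~: A, B, B] \subset 'Z(A)) ==>
          ([~: A, B] \subset 'Z(A))]]].

Fixpoint calKn (i : nat) S : {set {group gT}} :=
  if i is j.+1 then calK S (calKn j S) else subgroups S.

(* The intersection over all even i is infinite, hence the classical
   reflection of its membership condition into bool. *)
Definition calKinf S : {set {group gT}} :=
  [set A : {group gT} | `[< forall i, ~~ odd i -> A \in calKn i S >]].

Definition Kinf S : {group gT} := <<\bigcup_(A in calKinf S) A>>%G.

End Kinfty.

(* An isomorphism with domain S is an injective morphism defined on S; its
   codomain is the subgroup f @* S of an arbitrary ambient group rT. *)
Definition positive_char_pfunctor (p : nat)
    (F : forall gT : finGroupType, {group gT} -> {group gT}) : Prop :=
  [/\ forall (gT : finGroupType) (S : {group gT}),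
        p.-group S -> F gT S \subset S,
      forall (gT rT : finGroupType) (S : {group gT}) (f : {morphism S >-> rT}),
        p.-group S -> 'injm f -> F rT (f @* S)%G :=: f @* F gT S
    & forall (gT : finGroupType) (S : {group gT}),
        p.-group S -> S :!=: 1 -> F gT S :!=: 1].

(* Main.v *)
(** The operator [calK S] reverses inclusion, so the sets [calKn i S] are
    decreasing for even [i], each odd one is contained in each even one, and the
    even ones are eventually constant, equal to [calKinf S].  With
    [J = calKinf S] and [L = calK S J] this gives [calK S L = J].  When [T]
    contains [Kinf S], and hence every member of [J], comparing the sequences of
    [T] and [S] yields [calKinf T \subset J] (starting from [calKn 0 T \subset
    calKn 0 S]) as well as [J \subset calKinf T] (starting from [J \subset
    calKn 0 T]).  An abelian normal subgroup satisfies the conditions of [calK]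
    vacuously, and a maximal one is self-centralizing in a [p]-group. *)
Require Import Defs.
From mathcomp Require Import all_boot all_fingroup all_solvable.
From mathcomp Require Import boolp.

Set Implicit Arguments.
Unset Strict Implicit.
Unset Printing Implicit Defensive.

Local Open Scope group_scope.

(** A term of least cardinality works: each later term is a subset of it of no smaller size, hence
    equal to it. *)
Lemma decreasing_set_stable (I : finType) (X : nat -> {set I}) :
    (forall n, X n.+1 \subset X n) ->
  exists N, forall n, X N \subset X n.
Proof.
move=> decX.
have leX m n : m <= n -> X n \subset X m.
  by move/subnK<-; elim: (n - m) => // k; apply: subset_trans; rewrite addSn.
have exk: exists k, `[< exists n, #|X n| = k >].
  by exists #|X 0|; apply/asboolP; exists 0.
case: (ex_minnP exk) => k /asboolP[N <-] minN; exists N => n.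
have [/leX //|ltNn] := leqP n N.
have := leX _ _ (ltnW ltNn); rewrite subEproper => /predU1P[-> //|/proper_card].
by rewrite ltnNge minN //; apply/asboolP; exists n.
Qed.

Section CalK.

Variable gT : finGroupType.
Implicit Types (S T A B Q : {group gT}) (Sigma : {set {group gT}}).

Lemma calKP S Sigma A :
  reflect [/\ A \subset S, [~: A, A] \subset 'Z(A),
              forall Q, Q \in Sigma -> Q \subset 'N(A)
            & forall B Q, Q \in Sigma -> B \subset Q ->
                [~: A, B, B] \subset 'Z(A) -> [~: A, B] \subset 'Z(A)]
          (A \in calK S Sigma).
Proof.
rewrite !inE; apply: (iffP and4P) => [[sAS cl2 /forall_inP nA /forallP KA]|].
  split=> // B Q SQ sBQ cAB; apply: (implyP (implyP (KA B) _)) => //.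
  by apply/exists_inP; exists Q.
case=> sAS cl2 nA KA; split=> //; first exact/forall_inP.
apply/forallP=> B; apply/implyP=> /exists_inP[Q SQ sBQ].
by apply/implyP; apply: KA sBQ.
Qed.

(** The ambient group enters [calK] only through [A \subset S], so it can be exchanged while the
    reversal of inclusions is applied; [calKinf_over] does this in both directions. *)
Lemma calK_sub S T Sigma Sigma' : Sigma' \subset Sigma ->
    {in calK S Sigma, forall A, A \subset T} ->
  calK S Sigma \subset calK T Sigma'.
Proof.
move=> /subsetP sSS' sT; apply/subsetP=> A KA; have sAT := sT A KA.
have [_ cl2 nA zA] := calKP _ _ _ KA; apply/calKP.
by split=> // [Q /sSS'|B Q /sSS']; [apply: nA | apply: zA].
Qed.

Lemma calKn_sub i S A : A \in calKn i S -> A \subset S.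
Proof. by case: i => [|i]; [rewrite inE | case/calKP]. Qed.

Lemma calKS S Sigma Sigma' : Sigma' \subset Sigma ->
  calK S Sigma \subset calK S Sigma'.
Proof. by move/calK_sub; apply=> A /calKP[]. Qed.

Lemma calKn_sub0 i S : calKn i S \subset calKn 0 S.
Proof. by apply/subsetP=> A /calKn_sub; rewrite inE. Qed.

Lemma calKn_odd_sub_even a b S : calKn b.*2.+1 S \subset calKn a.*2 S.
Proof.
elim: a b => [|a IHa] b; first exact: calKn_sub0.
(* Two reversals reduce the pair [(a.+1, b.+1)] to [(a, b)]. *)
apply: calKS; case: b => [|b]; first exact: (calKn_sub0 a.*2.+1).
exact/calKS/IHa.
Qed.

Lemma calKn_even_decreasing a S : calKn a.+1.*2 S \subset calKn a.*2 S.
Proof. by elim: a => [|a IHa]; [apply: calKn_sub0 | do 2!apply: calKS]. Qed.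

Lemma calKinfP S A : reflect (forall n, A \in calKn n.*2 S) (A \in calKinf S).
Proof.
rewrite inE; apply: (iffP (asboolP _)) => [KA n|KA i /even_halfK <- //].
by apply: KA; rewrite odd_double.
Qed.

(** Two consecutive even indices are recorded because together they express the fixed point: with
    [J = calKinf S], they give [J = calK S (calK S J)]. *)
Lemma calKinf_stable S :
  exists2 N, calKinf S = calKn N.*2 S & calKinf S = calKn N.+1.*2 S.
Proof.
have stable M : (forall n, calKn M.*2 S \subset calKn n.*2 S) ->
    calKinf S = calKn M.*2 S.
  move=> minM; apply/setP=> A; apply/calKinfP/idP=> [|KA n]; first exact.
  exact: (subsetP (minM n)).
have [N minN] := decreasing_set_stable (calKn_even_decreasing^~ S).
exists N; apply: stable => // n.
exact: subset_trans (calKn_even_decreasing N S) (minN n).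
Qed.

Lemma calKinf_sub_Kinf S A : A \in calKinf S -> A \subset Kinf S.
Proof. by move=> KA; apply/sub_gen/(bigcup_sup A). Qed.

Lemma Kinf_sub S : Kinf S \subset S.
Proof.
by rewrite gen_subG; apply/bigcupsP=> A /calKinfP/(_ 0)/calKn_sub.
Qed.

Lemma calKinf_over S T : Kinf S \subset T -> T \subset S ->
  calKinf S = calKinf T.
Proof.
move=> sKT sTS; have sJT A : A \in calKinf S -> A \subset T.
  by move/calKinf_sub_Kinf/subset_trans; apply.
have sTn n : calKn n.*2 T \subset calKn n.*2 S.
  elim: n => [|n IHn].
    by apply/subsetP=> A; rewrite !inE => /subset_trans->.
  (* Members of an odd term for [S] lie in every even term, hence in [calKinf S], hence below
     [T]. *)
  have sST1: calKn n.*2.+1 S \subset calKn n.*2.+1 T.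
    apply: calK_sub => // A KA; apply/sJT/calKinfP=> m.
    exact: (subsetP (calKn_odd_sub_even m n S)).
  apply: calK_sub sST1 _ => A /(@calKn_sub n.+1.*2) sAT.
  exact: subset_trans sTS.
have [N defJ defJ2] := calKinf_stable S.
have sJTn n : calKinf S \subset calKn n.*2 T.
  elim: n => [|n IHn]; first by apply/subsetP=> A /sJT; rewrite inE.
  (* The induction hypothesis is read with [calKinf S] as term [N.*2]; below, [calKinf S] is read as
     term [N.+1.*2], so that [calK_sub] applies again. *)
  have sTS1: calKn n.*2.+1 T \subset calKn N.*2.+1 S.
    apply: calK_sub; first by move: IHn; rewrite defJ.
    by move=> A /(@calKn_sub n.*2.+1)/subset_trans->.
  rewrite defJ2.
  by apply: calK_sub sTS1 _ => A KA; apply: sJT; rewrite defJ2.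
apply/eqP; rewrite eqEsubset; apply/andP; split; apply/subsetP=> A KA.
  by apply/calKinfP=> n; apply: (subsetP (sJTn n)).
by apply/calKinfP=> n; apply: (subsetP (sTn n)); apply/calKinfP.
Qed.

(** Here ['Z(A) = A], and every [B] to be tested lies in [S], which normalizes [A]; so [[~: A, B]]
    always lies in ['Z(A)]. *)
Lemma abelian_normal_calKinf S A : A <| S -> abelian A -> A \in calKinf S.
Proof.
case/andP=> sAS nAS cAA; have zA := center_idP cAA.
apply/calKinfP=> n; case: {n}n.*2 => [|i]; first by rewrite inE.
apply/calKP; rewrite zA; split=> // [|Q KQ|B Q KQ sBQ _].
- by rewrite commg_subl normG.
- exact: subset_trans (calKn_sub KQ) nAS.
rewrite commg_subl; apply: subset_trans sBQ _.
exact: subset_trans (calKn_sub KQ) nAS.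
Qed.

Lemma abelian_normal_sub_Kinf S A : A <| S -> abelian A -> A \subset Kinf S.
Proof. by move=> nsAS cAA; apply/calKinf_sub_Kinf/abelian_normal_calKinf. Qed.

Lemma cent_Kinf_sub (p : nat) S : p.-group S -> 'C_S(Kinf S) \subset Kinf S.
Proof.
move=> pS.
have [A maxA _] : {A : {group gT} | [max A | A <| S & abelian A]
                                  & [1 gT]%G \subset A}.
  by apply: maxgroup_exists; rewrite normal1 abelian1.
(* The only use of [pS]: it gives ['C_S(A) = A], and centralizers reverse [A \subset Kinf S]. *)
have /SCN_P[nsAS cSA] := max_SCN pS maxA.
have /andP[_ cAA] := maxgroupp maxA.
have sAK := abelian_normal_sub_Kinf nsAS cAA.
by apply: (subset_trans _ sAK); rewrite -cSA setIS ?centS.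
Qed.

End CalK.

Section Isomorphism.

Variables (gT rT : finGroupType) (S : {group gT}) (f : {morphism S >-> rT}).
Hypothesis injf : 'injm f.
Implicit Types A B Q : {group gT}.

Lemma injm_subgroup (R : {group rT}) : R \subset f @* S ->
  exists2 A : {group gT}, A \subset S & R = (f @* A)%G.
Proof.
move=> sRS; exists (f @*^-1 R)%G; first exact: subsetIl.
by apply: val_inj; rewrite /= morphpreK.
Qed.

(** An injective morphism respects commutators, centres and normalizers. [Sigma] and [Sigma'] are
    matched by membership of subgroups of [S], which is the form the induction in [injm_calKn]
    supplies. *)
Lemma injm_calK (Sigma : {set {group gT}}) (Sigma' : {set {group rT}}) A :
    {in Sigma, forall Q, Q \subset S} ->
    {in Sigma', forall R : {group rT}, R \subset f @* S} ->
    (forall Q, Q \subset S -> ((f @* Q)%G \in Sigma') = (Q \in Sigma)) ->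
    A \subset S ->
  ((f @* A)%G \in calK (f @* S)%G Sigma') = (A \in calK S Sigma).
Proof.
move=> sSigma sSigma' memE sAS.
have sRS B : B \subset S -> [~: A, B] \subset S by apply: comm_subG.
have sRZ (X : {group gT}) : X \subset S ->
    (f @* X \subset 'Z(f @* A)) = (X \subset 'Z(A)).
  by move=> sXS; rewrite -injm_center // injmSK.
apply/calKP/calKP=> [] [_ cl2 nA zA]; split.
- by [].
- by rewrite -sRZ ?sRS // morphimR.
- move=> Q KQ; have sQS := sSigma Q KQ; rewrite -(injm_norms injf) //.
  by apply: (nA (f @* Q)%G); rewrite memE.
- move=> B Q KQ sBQ; have sQS := sSigma Q KQ; have sBS := subset_trans sBQ sQS.
  rewrite -!(sRZ [~: _, _]%G) ?sRS ?comm_subG ?sRS // !morphimR ?sRS //.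
  by apply: (zA (f @* B)%G (f @* Q)%G); rewrite ?memE ?morphimS.
- exact: morphimS.
- by rewrite /= -morphimR // sRZ ?sRS.
- move=> _ /[dup]/sSigma'/injm_subgroup[Q sQS ->]; rewrite memE // => KQ.
  by rewrite injm_norms ?nA.
move=> R _ /[dup]/sSigma'/injm_subgroup[Q sQS ->]; rewrite memE // => KQ sRQ.
(* The tested subgroup [R] is itself an image, so [zA] can be applied to its source [B]. *)
have [B sBS defR] := injm_subgroup (subset_trans sRQ (morphimS f sQS)).
rewrite {R}defR /= in sRQ *; rewrite injmSK // in sRQ.
rewrite -!morphimR ?sRS // (sRZ [~: _, _, _]%G) ?(sRZ [~: _, _]%G) ?sRS //.
  exact: (zA B Q).
by rewrite comm_subG ?sRS.
Qed.

Lemma injm_calKn i A : A \subset S ->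
  ((f @* A)%G \in calKn i (f @* S)%G) = (A \in calKn i S).
Proof.
elim: i A => [|i IHi] A sAS; first by rewrite !inE injmSK ?sAS.
by apply: injm_calK => // Q; apply: calKn_sub.
Qed.

Lemma injm_calKinf A : A \subset S ->
  ((f @* A)%G \in calKinf (f @* S)%G) = (A \in calKinf S).
Proof.
move=> sAS; apply/calKinfP/calKinfP=> KA n; have := KA n;
  by rewrite injm_calKn.
Qed.

Lemma injm_Kinf : Kinf (f @* S)%G :=: f @* Kinf S.
Proof.
apply/eqP; rewrite eqEsubset; apply/andP; split.
  rewrite gen_subG; apply/bigcupsP=> R KR.
  have [|A sAS defR] := @injm_subgroup R; first exact: (calKn_sub (calKinfP _ _ KR 0)).
  by rewrite defR morphimS // calKinf_sub_Kinf // -injm_calKinf // -defR.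
(* Passing to the preimage lets the inclusion be checked on the generators of [Kinf S]. *)
rewrite sub_morphim_pre ?Kinf_sub // gen_subG; apply/bigcupsP=> A KA.
have sAS: A \subset S by apply: (calKn_sub (calKinfP _ _ KA 0)).
by rewrite -sub_morphim_pre // (calKinf_sub_Kinf (A := (f @* A)%G)) // injm_calKinf.
Qed.

End Isomorphism.

Unset Implicit Arguments.

Theorem theoremA (p : nat) (p_pr : prime p) :
  positive_char_pfunctor p (@Kinf) /\
  forall (gT : finGroupType) (S : {group gT}), p.-group S ->
    [/\ forall T : {group gT},
          Kinf S \subset T -> T \subset S -> Kinf S :=: Kinf T,
        forall A : {group gT}, A <| S -> abelian A -> A \subset Kinf S,
        'C_S(Kinf S) \subset Kinf S
      & 'Z(S) \subset Kinf S].
Proof.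
have sZK (gT : finGroupType) (S : {group gT}) : 'Z(S) \subset Kinf S.
  exact: abelian_normal_sub_Kinf (center_normal S) (center_abelian S).
split=> [|gT S pS]; split=> //.
- by move=> gT S _; apply: Kinf_sub.
- by move=> gT rT S f _ injf; apply: injm_Kinf.
(* A nontrivial [p]-group has a nontrivial centre, which lies in [Kinf S]. *)
- move=> gT S pS; apply: contraNneq => K1.
  by apply/eqP/(trivg_center_pgroup pS)/trivgP; rewrite -K1 sZK.
- by move=> T sKT sTS; rewrite /Kinf /= (calKinf_over sKT sTS).
- by move=> A; apply: abelian_normal_sub_Kinf.
exact: cent_Kinf_sub pS.
Qed.
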